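(* Let $P_1$ and $P_2$ be nonnegative real forms of the same degree in the same variables such that $P_1^k$ and $P_2$ are both sums of squares for some odd $k\ge 1$. Then $(P_1+P_2)^k$ is also a sum of squares.
   Context: A real form in $n$ variables is nonnegative if it takes only nonnegative values on $\mathbb{R}^n$. A form of degree $d$ is a sum of squares if it equals $H_1^2+\dots+H_r^2$ for some real forms $H_i$ of degree $d/2$. *)

(* Defs.v *)
From mathcomp Require Import all_boot all_order all_algebra.
From mathcomp Require Import reals.
From mathcomp Require Import mpoly.

Set Implicit Arguments.
Unset Strict Implicit.
Unset Printing Implicit Defensive.

Import Order.TTheory GRing.Theory Num.Theory.
Local Open Scope ring_scope.

(* Forms of degree d are the polynomials P \is d.-homog; the zero polynomial
   is a form of every degree. *)

Definition nonneg_form (R : realType) (n : nat) (P : {mpoly R[n]}) : Prop :=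
  forall v : 'I_n -> R, 0 <= P.@[v].

(* The degree d is explicit because the zero form does not determine it, and
   d/2 is required to be an integer rather than rounded down. *)
Definition sos_form (R : realType) (n d : nat) (P : {mpoly R[n]}) : Prop :=
  exists2 e : nat, d = (2 * e)%N &
  exists (r : nat) (H : 'I_r -> {mpoly R[n]}),
    (forall i, H i \is e.-homog) /\ P = \sum_(i < r) H i ^+ 2.

(* Main.v *)
Require Import Defs.
From mathcomp Require Import all_boot all_order all_algebra.
From mathcomp Require Import reals.
From mathcomp Require Import mpoly.
From mathcomp Require Import ring.
Import Order.TTheory GRing.Theory Num.Theory.
Local Open Scope ring_scope.

(** Since t |-> t ^ k is increasing for odd k, the quotient Q of
    A ^ k - B ^ k by A - B is a nonnegative binary form in A and B of even
    degree k - 1, hence a sum of squares of forms in A and B; this is explicit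
    in [odd_power_quotient_sos].  With A = P1 + P2 and B = P1 it gives
      (P1 + P2) ^ k = P1 ^ k + P2 * Q,
    and the right-hand side is a sum of squares because sums of squares are
    stable under sums ([sos_formD]) and products ([sos_formM]). *)

Lemma sos_form_sqr (R : realType) (n e : nat) (H : {mpoly R[n]}) :
  H \is e.-homog -> sos_form (2 * e) (H ^+ 2).
Proof.
move=> hH; exists e => //; exists 1%N, (fun _ => H); split=> //.
by rewrite big_ord1.
Qed.

Lemma sos_form0 (R : realType) (n e : nat) :
  sos_form (2 * e) (0 : {mpoly R[n]}).
Proof.
exists e => //; exists 0%N, (fun _ => 0); split; first by case.
by rewrite big_ord0.
Qed.

Lemma sos_formD (R : realType) (n d : nat) (P Q : {mpoly R[n]}) :
  sos_form d P -> sos_form d Q -> sos_form d (P + Q).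
Proof.
case=> e -> [r [H [hH ->]]] [e' /eqP]; rewrite eqn_pmul2l // => /eqP <-.
case=> s [G [hG ->]]; exists e => //.
exists (r + s)%N,
  (fun i => match split i with inl j => H j | inr j => G j end).
split=> [i|]; first by case: (split i).
rewrite big_split_ord; congr (_ + _); apply: eq_bigr => i _.
  by rewrite (unsplitK (inl i)).
by rewrite (unsplitK (inr i)).
Qed.

Lemma sos_form_sum (R : realType) (n e r : nat) (F : 'I_r -> {mpoly R[n]}) :
  (forall i, sos_form (2 * e) (F i)) -> sos_form (2 * e) (\sum_(i < r) F i).
Proof.
move=> hF; apply: (big_ind (sos_form (2 * e))) => //.
  exact: sos_form0.
exact: sos_formD.
Qed.

Lemma sos_formM (R : realType) (n c d : nat) (P Q : {mpoly R[n]}) :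
  sos_form c P -> sos_form d Q -> sos_form (c + d) (P * Q).
Proof.
case=> e -> [r [H [hH ->]]] [f -> [s [G [hG ->]]]].
rewrite -mulnDr big_distrlr /=.
apply: sos_form_sum => i; apply: sos_form_sum => j.
by rewrite -exprMn; apply: sos_form_sqr; apply: dhomogM.
Qed.

Lemma sos_formZ (R : realType) (n d : nat) (c : R) (P : {mpoly R[n]}) :
  0 <= c -> sos_form d P -> sos_form d (c *: P).
Proof.
move=> c_ge0 [e -> [r [H [hH ->]]]]; exists e => //.
exists r, (fun i => Num.sqrt c *: H i); split=> [i|].
  exact: rpredZ.
rewrite scaler_sumr; apply: eq_bigr => i _.
by rewrite exprZn sqr_sqrtr.
Qed.

(** Twice the quotient Q is D + A ^ (2 m), where
      D = B ^ (2 m) + \sum_(j < m) (A ^ j * B ^ (m - 1 - j) * (A + B)) ^ 2 :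
    the cross terms of the squares give twice the odd powers of A in Q, and
    each even power other than the two extreme ones comes from two
    consecutive squares.  Keeping A ^ (2 m) apart from D is what makes the
    induction on m linear: D is multiplied by B ^ 2 and gains one square. *)
Lemma odd_power_quotient_sos (R : realType) (n d m : nat)
    (A B : {mpoly R[n]}) :
  A \is d.-homog -> B \is d.-homog ->
  exists2 Q, sos_form (d * (2 * m)) Q &
    A ^+ (2 * m).+1 - B ^+ (2 * m).+1 = (A - B) * Q.
Proof.
move=> hA hB.
have even_deg j : (d * (2 * j) = 2 * (d * j))%N by rewrite mulnCA.
have [D sosD eqD] : exists2 D, sos_form (d * (2 * m)) D &
    2%:R * (A ^+ (2 * m).+1 - B ^+ (2 * m).+1) = (A - B) * (D + A ^+ (2 * m)).
  elim: m => [|m [D sosD eqD]].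
    exists 1; last by rewrite muln0 !expr1 expr0; ring.
    by rewrite even_deg -(expr1n _ 2); apply: sos_form_sqr; rewrite muln0 dhomog1.
  exists (B ^+ 2 * D + (A ^+ m * (A + B)) ^+ 2).
    apply: sos_formD.
      have -> : (d * (2 * m.+1) = 2 * d + d * (2 * m))%N.
        by rewrite mulnS mulnDr (mulnC d 2).
      by apply: sos_formM => //; exact: sos_form_sqr.
    rewrite even_deg mulnSr; apply: sos_form_sqr.
    by apply: dhomogM; [exact: dhomogMn | exact: rpredD].
  have -> : (2 * m.+1 = (2 * m).+2)%N by rewrite mulnS.
  have -> : 2%:R * (A ^+ (2 * m).+3 - B ^+ (2 * m).+3) =
      B ^+ 2 * (2%:R * (A ^+ (2 * m).+1 - B ^+ (2 * m).+1))
      + 2%:R * A ^+ (2 * m).+1 * (A ^+ 2 - B ^+ 2).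
    by rewrite !exprS; ring.
  rewrite eqD !exprS expr0 mulr1 (mulnC 2) exprM expr2.
  by move: (A ^+ m) => Am; ring.
exists (2%:R^-1 *: (D + A ^+ (2 * m))).
  apply: sos_formZ; first by rewrite invr_ge0 ler0n.
  apply: sos_formD => //.
  by rewrite even_deg (mulnC 2 m) exprM; apply/sos_form_sqr/dhomogMn.
rewrite -scalerAr -eqD mulr_natl -scaler_nat scalerA mulVf ?scale1r //.
by rewrite pnatr_eq0.
Qed.

Theorem theorem42 (R : realType) (n d k : nat) (P1 P2 : {mpoly R[n]})
  (hP1 : P1 \is d.-homog) (hP2 : P2 \is d.-homog)
  (nonnegP1 : nonneg_form P1) (nonnegP2 : nonneg_form P2)
  (hk1 : (1 <= k)%N) (hk : odd k)
  (sosP1 : sos_form (d * k) (P1 ^+ k)) (sosP2 : sos_form d P2) :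
  sos_form (d * k) ((P1 + P2) ^+ k).
Proof.
have Dk : k = (2 * k./2).+1 by rewrite mul2n -[LHS]odd_double_half hk.
have [Q sosQ] := odd_power_quotient_sos _ _ _ k./2 _ _ 
  (rpredD hP1 hP2) hP1.
rewrite -Dk [P1 + P2 - P1]addrAC subrr add0r => /eqP.
rewrite subr_eq addrC => /eqP ->.
apply: sos_formD => //.
by rewrite Dk mulnS; apply: sos_formM.
Qed.
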